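(* There is an absolute constant $c>0$ such that for any $d\ge 2$, $0<\varepsilon<\frac{1}{10}$ and $0<\delta<\frac14$, there exist finite sets $\mathcal{X}\subset\mathbb{R}^d$ and $\mathcal{Y}\subset\mathbb{R}$ with $|\mathcal{Y}|=2$ such that any algorithm that solves the distributional active $\ell_1$ regression problem on $\mathcal{X}\times\mathcal{Y}$ with accuracy $\varepsilon$ and failure probability $\delta$ requires at least $c\left(\frac{d}{\varepsilon^2}+\frac{1}{\varepsilon^2}\log\frac1\delta+d\log\frac1\delta\right)$ samples.
   Context: Distributional active $\ell_1$ regression on $\mathcal{X}\times\mathcal{Y}$ (with $\mathcal{X}\subset\mathbb{R}^d$, $\mathcal{Y}\subset\mathbb{R}$ finite, $|\mathcal{Y}|=2$): there is an unknown joint distribution $P$ on $\mathcal{X}\times\mathcal{Y}$. The learner may adaptively choose points $x\in\mathcal{X}$ and for each chosen $x$ observes an independent sample of the label from the conditional distribution $P(\cdot\mid X=x)$; the number of such queries is the number of samples. The algorithm solves the problem with accuracy $\varepsilon$ and failure probability $\delta$ if, for every such distribution $P$, with probability at least $1-\delta$ it returns $\widehat\beta\in\mathbb{R}^d$ with $\mathbb{E}_{(X,Y)\sim P}\big[|X^\top\widehat\beta-Y|\big]\le(1+\varepsilon)\inf_{\beta}\mathbb{E}_{(X,Y)\sim P}\big[|X^\top\beta-Y|\big]$. *)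

(* Defs.v *)
From HB Require Import structures.
From mathcomp Require Import all_boot all_order all_algebra.
From mathcomp Require Import classical_sets boolp reals exp.
From mathcomp Require Import Rstruct.
Set Implicit Arguments. Unset Strict Implicit. Unset Printing Implicit Defensive.
Import Order.TTheory GRing.Theory Num.Theory.
Local Open Scope ring_scope.
Local Open Scope classical_set_scope.

Section ActiveL1.
Variable R : realType.

(* A distribution P on X x Y, where X = {pts i | i < n} and Y = {y0, y1},
   is given by its marginal p on the (indices of the) points of X and by the
   conditional law of the label: q i = P(Y = y1 | X = pts i). *)
Definition is_marginal (n : nat) (p : 'I_n -> R) : Prop :=
  (forall i, 0 <= p i) /\ \sum_(i < n) p i = 1.

Definition is_conditional (n : nat) (q : 'I_n -> R) : Prop :=
  forall i, 0 <= q i <= 1.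

Definition dotv (d : nat) (x b : 'rV[R]_d) : R := (x *m b^T) 0 0.

Definition l1_risk (n d : nat) (pts : 'I_n -> 'rV[R]_d) (y0 y1 : R)
    (p q : 'I_n -> R) (b : 'rV[R]_d) : R :=
  \sum_(i < n) p i *
     (q i * `|dotv (pts i) b - y1| + (1 - q i) * `|dotv (pts i) b - y0|).

Definition good_set (n d : nat) (pts : 'I_n -> 'rV[R]_d) (y0 y1 : R)
    (p q : 'I_n -> R) (eps : R) : set 'rV[R]_d :=
  [set b | l1_risk pts y0 y1 p q b <=
           (1 + eps) * inf (range (l1_risk pts y0 y1 p q))].

(* A (randomized, adaptive) active learner on n points of R^d.
   A history is the sequence of (queried point, observed label) pairs, the
   label being encoded as a bool (true <-> y1, false <-> y0).
   - next_query h : law of the next queried point given history h;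
   - output h     : law of the returned parameter given the final history h,
                    given as a finitely additive probability on all subsets
                    of R^d (this contains every measurable output kernel). *)
Record learner (n d : nat) := Learner {
  next_query : seq ('I_n * bool) -> 'I_n -> R;
  output : seq ('I_n * bool) -> set 'rV[R]_d -> R }.

Definition valid_learner (n d : nat) (A : learner n d) : Prop :=
  [/\ (forall h i, 0 <= next_query A h i),
      (forall h, \sum_(i < n) next_query A h i = 1),
      (forall h S, 0 <= output A h S),
      (forall h, output A h setT = 1) &
      (forall h S T, S `&` T = set0 ->
         output A h (S `|` T) = output A h S + output A h T)].

Definition label_prob (n : nat) (q : 'I_n -> R) (ib : 'I_n * bool) : R :=
  if ib.2 then q ib.1 else 1 - q ib.1.

Definition output_prob (n d m : nat) (A : learner n d) (q : 'I_n -> R)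
    (S : set 'rV[R]_d) : R :=
  \sum_(h : m.-tuple ('I_n * bool))
     (\prod_(t < m) (next_query A (take t h) (tnth h t).1 *
                     label_prob q (tnth h t))) * output A h S.

(* The learner family A (which may depend on the known marginal of X) solves
   distributional active l1 regression on X x Y with accuracy eps and failure
   probability delta using m samples. *)
Definition solves (n d m : nat) (pts : 'I_n -> 'rV[R]_d) (y0 y1 : R)
    (eps delta : R) (A : ('I_n -> R) -> learner n d) : Prop :=
  forall p : 'I_n -> R, is_marginal p ->
    valid_learner (A p) /\
    forall q : 'I_n -> R, is_conditional q ->
      1 - delta <= output_prob m (A p) q (good_set pts y0 y1 p q eps).

End ActiveL1.

(* Main.v *)
Require Import Defs.
From HB Require Import structures.
From mathcomp Require Import all_boot all_order all_algebra.
From mathcomp Require Import classical_sets boolp reals exp.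
From mathcomp Require Import Rstruct.
From mathcomp Require Import sequences.
From mathcomp Require Import ring lra.
Import Order.TTheory GRing.Theory Num.Theory.
Local Open Scope ring_scope.

(* The instance is the standard basis of R^d with labels 0 and 1, on which the
   risk splits into d separate one-dimensional problems.
   - Under a uniform marginal and biases 1/2 +- 4 eps, a good output must round
     to the right sign in all but d/8 of the coordinates.  By Assouad's argument
     on the hypercube of signs, with pairs of neighbours compared through their
     Hellinger affinity, this forces m >= c d / eps^2.
   - If the marginal sits at a single point, a good output determines the sign
     there.  The affinity of two neighbours is at least (1 - 64 eps^2)^(m/2), so
     the testing error cannot drop below delta unless m >= c log(1/delta) / eps^2.
   - If no label is ever 1 then the optimal risk is 0, and the output must vanish
     at every point; this is bad if one unknown point i has bias 3/4.  Some i is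
     visited at most m/d times on average, and seeing only zeros there has
     probability 4^(- number of visits); hence m >= c d log(1/delta).
   For delta >= 1/16 the first bound dominates the other two. *)

(** * Transcripts of an adaptive policy: total weight, visits, affinity *)

Section Transcripts.
Set Implicit Arguments. Unset Strict Implicit.
Variables (R : realType) (n : nat).
Implicit Types (nq : seq ('I_n * bool) -> 'I_n -> R) (l : 'I_n * bool -> R).

Definition policy nq : Prop :=
  (forall h i, 0 <= nq h i) /\ (forall h, \sum_(i < n) nq h i = 1).

(* The probability of a transcript when [l] is the law of the labels; [l] may also
   be unnormalized, e.g. the geometric mean of two label laws. *)
Definition weight nq l m (h : m.-tuple ('I_n * bool)) : R :=
  \prod_(t < m) (nq (take t h) (tnth h t).1 * l (tnth h t)).

Definition visits m (i : 'I_n) (h : m.-tuple ('I_n * bool)) : nat :=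
  (\sum_(t < m) ((tnth h t).1 == i))%N.

(** The policy that remains once the first query and its label are revealed; it drives the
    inductions on [m]. *)
Definition shift nq x := fun h => nq (x :: h).

Lemma policy_shift nq x : policy nq -> policy (shift nq x).
Proof. by move=> [nq0 nq1]; split=> h; [apply: nq0|apply: nq1]. Qed.

Lemma sum_cons_tuple (T : finType) m (F : m.+1.-tuple T -> R) :
  \sum_h F h = \sum_x \sum_(h : m.-tuple T) F [tuple of x :: h].
Proof.
rewrite pair_big /= (reindex (fun p : T * m.-tuple T => [tuple of p.1 :: p.2])) //=.
exists (fun h => (thead h, [tuple of behead h])) => [[x h] _|h _] /=.
  by congr pair; apply: val_inj.
by rewrite [RHS]tuple_eta.
Qed.

Lemma sum_pair_bool (F : 'I_n * bool -> R) :
  \sum_x F x = \sum_(i < n) (F (i, true) + F (i, false)).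
Proof.
transitivity (\sum_(i < n) \sum_(b : bool) F (i, b)).
  by rewrite pair_big /=; apply: eq_bigr => -[].
by apply: eq_bigr => i _; rewrite big_bool.
Qed.

Lemma weight_cons nq l m x (h : m.-tuple ('I_n * bool)) :
  weight nq l [tuple of x :: h] = nq [::] x.1 * l x * weight (shift nq x) l h.
Proof.
rewrite /weight big_ord_recl /= tnth0; congr (_ * _).
by apply: eq_bigr => t _; rewrite tnthS.
Qed.

Lemma visits_cons m i x (h : m.-tuple ('I_n * bool)) :
  visits i [tuple of x :: h] = ((x.1 == i) + visits i h)%N.
Proof.
rewrite /visits big_ord_recl /= tnth0; congr (_ + _)%N.
by apply: eq_bigr => t _; rewrite tnthS.
Qed.

Lemma weight_ge0 nq l m (h : m.-tuple ('I_n * bool)) :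
  policy nq -> (forall x, 0 <= l x) -> 0 <= weight nq l h.
Proof. by move=> [nq0 _] l0; apply: prodr_ge0 => t _; rewrite mulr_ge0. Qed.

Lemma sum_visits m (h : m.-tuple ('I_n * bool)) : (\sum_(i < n) visits i h = m)%N.
Proof.
rewrite /visits exchange_big /= -[RHS]card_ord -sum1_card; apply: eq_bigr => t _.
rewrite (bigD1 (tnth h t).1) //= eqxx big1 ?addn0 // => i /negbTE.
by rewrite eq_sym => ->.
Qed.

(** For a label law [l] this is the total mass 1. For the geometric mean of two label laws it is the
    Hellinger affinity of the two transcript laws. *)
Definition transcript_sum nq l m := \sum_(h : m.-tuple ('I_n * bool)) weight nq l h.
Definition visit_sum nq l m i :=
  \sum_(h : m.-tuple ('I_n * bool)) weight nq l h * (visits i h)%:R.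

Lemma transcript_sum0 nq l : transcript_sum nq l 0 = 1.
Proof.
rewrite /transcript_sum (eq_bigr (fun=> 1)) => [|h _]; last by rewrite /weight big_ord0.
by rewrite sumr_const card_tuple.
Qed.

Lemma transcript_sumS nq l m :
  transcript_sum nq l m.+1 =
  \sum_x nq [::] x.1 * l x * transcript_sum (shift nq x) l m.
Proof.
rewrite /transcript_sum sum_cons_tuple; apply: eq_bigr => x _.
by rewrite mulr_sumr; apply: eq_bigr => h _; rewrite weight_cons.
Qed.

(** Wherever the policy queries, one step multiplies the total by at least [r]. With [l] a geometric
    mean, this bounds the affinity even if every query hits the informative point. *)
Lemma transcript_sum_ge nq l m r : policy nq -> (forall x, 0 <= l x) -> 0 <= r ->
  (forall i, r <= l (i, true) + l (i, false)) -> r ^+ m <= transcript_sum nq l m.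
Proof.
move=> + l0 r0 lr; elim: m nq => [|m IH] nq pnq; first by rewrite transcript_sum0.
have [nq0 nq1] := pnq.
rewrite transcript_sumS.
apply: (@le_trans _ _ (\sum_x nq [::] x.1 * l x * r ^+ m)); last first.
  by apply: ler_sum => x _; rewrite ler_wpM2l ?mulr_ge0 // IH //; apply: policy_shift.
rewrite sum_pair_bool exprS -[r in r * _]mul1r -(nq1 [::]) !mulr_suml.
apply: ler_sum => i _ /=.
by rewrite -mulrDl -mulrDr ler_wpM2r ?exprn_ge0 // ler_wpM2l.
Qed.

Lemma transcript_sum_eq1 nq l m : policy nq ->
  (forall i, l (i, true) + l (i, false) = 1) -> transcript_sum nq l m = 1.
Proof.
move=> + l1; elim: m nq => [|m IH] nq pnq; first by rewrite transcript_sum0.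
rewrite transcript_sumS (eq_bigr (fun x => nq [::] x.1 * l x)) => [|x _]; last first.
  by rewrite IH ?mulr1 //; apply: policy_shift.
rewrite sum_pair_bool -(proj2 pnq [::]); apply: eq_bigr => i _.
by rewrite -mulrDr l1 mulr1.
Qed.

Lemma visit_sumS nq l m i : policy nq ->
  (forall j, l (j, true) + l (j, false) = 1) ->
  visit_sum nq l m.+1 i =
  nq [::] i + \sum_x nq [::] x.1 * l x * visit_sum (shift nq x) l m i.
Proof.
move=> pnq l1; rewrite /visit_sum sum_cons_tuple.
transitivity (\sum_x (nq [::] x.1 * l x * (x.1 == i)%:R +
                nq [::] x.1 * l x * visit_sum (shift nq x) l m i)).
  apply: eq_bigr => x _.
  have -> : nq [::] x.1 * l x * (x.1 == i)%:R =
      \sum_(h : m.-tuple ('I_n * bool))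
         nq [::] x.1 * l x * (x.1 == i)%:R * weight (shift nq x) l h.
    by rewrite -mulr_sumr -/(transcript_sum _ _ _) transcript_sum_eq1 ?mulr1 //; apply: policy_shift.
  rewrite mulr_sumr -big_split /=; apply: eq_bigr => h _.
  by rewrite weight_cons visits_cons natrD; ring.
rewrite big_split /=; congr (_ + _).
rewrite sum_pair_bool (bigD1 i) //= big1 ?addr0 => [|j /negbTE ->].
  by rewrite eqxx !mulr1 -mulrDr l1 mulr1.
by rewrite !mulr0 addr0.
Qed.

Lemma sum_visit_sum nq l m : policy nq ->
  (forall j, l (j, true) + l (j, false) = 1) ->
  \sum_(i < n) visit_sum nq l m i = m%:R.
Proof.
move=> pnq l1; rewrite /visit_sum exchange_big /=.
transitivity (transcript_sum nq l m * m%:R); last first.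
  by rewrite transcript_sum_eq1 // mul1r.
rewrite mulr_suml; apply: eq_bigr => h _; rewrite -mulr_sumr; congr (_ * _).
by rewrite -natr_sum sum_visits.
Qed.

(* Induction on [m], revealing the first query; it needs the general initial
   weights [a], [b] and their geometric mean [c], and uses [c <= (a + b) / 2]. *)
Lemma affinity_ge nq l0 l1 g m i r :
  policy nq -> (forall x, 0 <= l0 x) -> (forall x, 0 <= l1 x) ->
  (forall x, 0 <= g x) -> (forall x, g x ^+ 2 = l0 x * l1 x) ->
  (forall j, l0 (j, true) + l0 (j, false) = 1) ->
  (forall j, l1 (j, true) + l1 (j, false) = 1) ->
  r <= 1 -> (forall j, g (j, true) + g (j, false) = if j == i then r else 1) ->
  1 - (1 - r) / 2 * (visit_sum nq l0 m i + visit_sum nq l1 m i)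
  <= transcript_sum nq g m.
Proof.
move=> pnq l0_ge0 l1_ge0 g_ge0 gE l0_1 l1_1 r1 g_sum.
suff gen (a b c : R) : 0 <= a -> 0 <= b -> 0 <= c -> c ^+ 2 = a * b ->
    c - (1 - r) / 2 * (a * visit_sum nq l0 m i + b * visit_sum nq l1 m i)
    <= c * transcript_sum nq g m.
  by have := gen 1 1 1; rewrite !mul1r expr1n; apply.
elim: m nq pnq a b c => [|m IH] nq pnq a b c a0 b0 c0 cE.
  rewrite transcript_sum0 mulr1 gerBl mulr_ge0 ?divr_ge0 ?subr_ge0 //.
  by rewrite addr_ge0 // mulr_ge0 // sumr_ge0 // => h _;
    rewrite mulr_ge0 // weight_ge0.
have [nq0 nq1] := pnq.
have cab : c <= (a + b) / 2.
  rewrite -(ler_pXn2r (n := 2)) ?nnegrE ?divr_ge0 ?addr_ge0 // cE.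
  by have := sqr_ge0 (a - b); lra.
rewrite transcript_sumS !visit_sumS // mulr_sumr.
apply: (@le_trans _ _ (\sum_x (nq [::] x.1 * (c * g x) - (1 - r) / 2 *
    (a * (nq [::] x.1 * l0 x * visit_sum (shift nq x) l0 m i) +
     b * (nq [::] x.1 * l1 x * visit_sum (shift nq x) l1 m i))))); last first.
  apply: ler_sum => x _.
  have := IH _ (policy_shift x pnq) (a * l0 x) (b * l1 x) (c * g x).
  move=> /(_ (mulr_ge0 a0 (l0_ge0 x)) (mulr_ge0 b0 (l1_ge0 x)))
         /(_ (mulr_ge0 c0 (g_ge0 x))).
  rewrite exprMn cE gE mulrACA => /(_ erefl) /(ler_wpM2l (nq0 [::] x.1)).
  lra.
rewrite sumrB -mulr_sumr big_split /= -!mulr_sumr.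
set V0 := \sum_x _ * visit_sum _ l0 _ _; set V1 := \sum_x _ * visit_sum _ l1 _ _.
(* Only a first query at [i] loses affinity, a fraction [1 - r] of [c]; the loss is charged to the
   visit split off by [visit_sumS]. *)
suff -> : \sum_x nq [::] x.1 * (c * g x) = c - (1 - r) * nq [::] i * c.
  have : (1 - r) * nq [::] i * c <= (1 - r) * nq [::] i * ((a + b) / 2).
    by rewrite ler_wpM2l ?mulr_ge0 ?subr_ge0.
  lra.
rewrite sum_pair_bool (eq_bigr (fun j => c * (nq [::] j * (if j == i then r else 1)))).
  rewrite -mulr_sumr (bigD1 i) //= eqxx.
  have -> : \sum_(j < n | j != i) nq [::] j * (if j == i then r else 1) = 1 - nq [::] i.
    have := nq1 [::]; rewrite (bigD1 i) //= => nqE.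
    transitivity (\sum_(j < n | j != i) nq [::] j); last lra.
    by apply: eq_bigr => j /negbTE ->; rewrite mulr1.
  ring.
by move=> j _ /=; rewrite -g_sum; ring.
Qed.

End Transcripts.

(** * Testing errors: affinity bounds and change of measure *)

Section Testing.
Set Implicit Arguments. Unset Strict Implicit.
Variables (R : realType) (n : nat).
Implicit Types (nq : seq ('I_n * bool) -> 'I_n -> R) (l : 'I_n * bool -> R).

Lemma weight_sqr nq l0 l1 g m (h : m.-tuple ('I_n * bool)) :
  (forall x, g x ^+ 2 = l0 x * l1 x) ->
  weight nq g h ^+ 2 = weight nq l0 h * weight nq l1 h.
Proof.
move=> gE; rewrite /weight -prodrXl -big_split /=; apply: eq_bigr => t _.
by rewrite exprMn gE; ring.
Qed.

(** For [a <= b] this is AM-GM applied to [(1 + c) * a] and [c * b]. Being linear in [a], [b] and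
    [g], it sums over transcripts and replaces the Cauchy-Schwarz step from affinity to testing
    error. *)
Lemma min_affinity (a b g k c : R) :
  0 <= a -> 0 <= b -> 0 <= g -> g ^+ 2 = a * b -> 0 <= c -> 0 <= k ->
  k ^+ 2 <= 4 * (c * (1 + c)) -> k * g <= Num.min a b + c * (a + b).
Proof.
move=> a0 b0 g0 gE c0 k0 kc.
wlog ab : a b a0 b0 gE / a <= b => [wlg|].
  case/orP: (le_total a b) => [ab|ba]; first exact: wlg.
  by rewrite minC [a + b]addrC; apply: wlg => //; rewrite gE mulrC.
rewrite min_l // -(ler_pXn2r (n := 2)) ?nnegrE ?addr_ge0 ?mulr_ge0 ?addr_ge0 //.
rewrite exprMn gE.
have := ler_wpM2r (mulr_ge0 a0 b0) kc.
have := sqr_ge0 ((1 + c) * a - c * b).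
lra.
Qed.

Lemma sum_min_ge nq l0 l1 g m (k c : R) :
  policy nq -> (forall x, 0 <= l0 x) -> (forall x, 0 <= l1 x) ->
  (forall x, 0 <= g x) -> (forall x, g x ^+ 2 = l0 x * l1 x) ->
  (forall j, l0 (j, true) + l0 (j, false) = 1) ->
  (forall j, l1 (j, true) + l1 (j, false) = 1) ->
  0 <= c -> 0 <= k -> k ^+ 2 <= 4 * (c * (1 + c)) ->
  k * transcript_sum nq g m - 2 * c <=
  \sum_(h : m.-tuple ('I_n * bool)) Num.min (weight nq l0 h) (weight nq l1 h).
Proof.
move=> pnq l0_ge0 l1_ge0 g_ge0 gE l0_1 l1_1 c0 k0 kc.
have -> : 2 * c = c * (transcript_sum nq l0 m + transcript_sum nq l1 m).
  by rewrite !transcript_sum_eq1 //; ring.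
rewrite lerBlDr -big_split !mulr_sumr -big_split; apply: ler_sum => h _ /=.
by apply: min_affinity; rewrite ?weight_ge0 ?(weight_sqr _ _ gE).
Qed.

(** A randomized test choosing with probability [t] cannot err less than the best deterministic
    choice. *)
Lemma min_le_mix (a b t : R) : 0 <= t <= 1 -> Num.min a b <= a * (1 - t) + b * t.
Proof.
move=> /andP[t0 t1].
have ma : Num.min a b <= a by rewrite ge_min lexx.
have mb : Num.min a b <= b by rewrite ge_min lexx orbT.
have := ler_wpM2r t0 mb.
have : Num.min a b * (1 - t) <= a * (1 - t) by rewrite ler_wpM2r // subr_ge0.
lra.
Qed.

(* Likelihood ratios are at least [exp (- lam N)] with [N] the number of visits to
   [i], and Markov's inequality bounds the event [N > tau]. *)
Lemma change_of_measure nq l0 l1 m i (lam tau : R)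
    (psi : m.-tuple ('I_n * bool) -> R) :
  policy nq -> (forall x, 0 <= l0 x) -> 0 <= lam -> 0 < tau ->
  (forall x, l0 x * expR (- (lam * (x.1 == i)%:R)) <= l1 x) ->
  (forall h, 0 <= psi h <= 1) ->
  expR (- (lam * tau)) *
    (\sum_h weight nq l0 h * psi h - visit_sum nq l0 m i / tau)
  <= \sum_h weight nq l1 h * psi h.
Proof.
move=> pnq l0_ge0 lam0 tau0 l01 psi01; have [nq0 _] := pnq.
have w01 (h : m.-tuple ('I_n * bool)) :
    weight nq l0 h * expR (- (lam * (visits i h)%:R)) <= weight nq l1 h.
  rewrite /visits natr_sum mulr_sumr -sumrN expR_sum -big_split /=.
  apply: ler_prod => t _.
  rewrite -mulrA ler_wpM2l // andbT !mulr_ge0 //.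
  by rewrite expR_ge0.
rewrite /visit_sum mulr_suml -sumrB mulr_sumr; apply: ler_sum => h _.
have /andP[psi0 psi1] := psi01 h.
apply: le_trans (ler_wpM2r psi0 (w01 h)).
have w0 : 0 <= weight nq l0 h by exact: weight_ge0.
set N : R := (visits i h)%:R; have N0 : 0 <= N / tau by rewrite divr_ge0 ?ler0n // ltW.
rewrite -[X in _ * (_ - X)]mulrA -mulrBr mulrCA -mulrA ler_wpM2l //.
have [le_N|lt_N] := leP N tau.
  have : expR (- (lam * tau)) <= expR (- (lam * N)).
    by rewrite ler_expR lerN2 ler_wpM2l.
  move=> /(ler_wpM2r psi0); apply: le_trans.
  by rewrite ler_wpM2l ?expR_ge0 // gerBl.
(* Past [tau] the left side is nonpositive because [psi h <= 1 <= N / tau]: Markov's inequality,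
   applied transcript by transcript. *)
apply: (@le_trans _ _ 0); last by rewrite mulr_ge0 ?expR_ge0.
rewrite mulr_ge0_le0 ?expR_ge0 // subr_le0 (le_trans psi1) //.
by rewrite ler_pdivlMr // mul1r ltW.
Qed.

End Testing.

(** * Finitely additive output laws *)

Section Outputs.
Set Implicit Arguments. Unset Strict Implicit.
Variables (R : realType) (n d : nat) (A : learner R n d).
Hypothesis validA : valid_learner A.
Local Open Scope classical_set_scope.
Implicit Types S T : set 'rV[R]_d.

Lemma next_query_policy : policy (next_query A).
Proof. by case: validA. Qed.

Lemma output_ge0 h S : 0 <= output A h S.
Proof. by case: validA. Qed.

Lemma outputT h : output A h setT = 1.
Proof. by case: validA. Qed.

Lemma outputU h S T : S `&` T = set0 ->
  output A h (S `|` T) = output A h S + output A h T.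
Proof. by case: validA => _ _ _ _; apply. Qed.

Lemma output0 h : output A h set0 = 0.
Proof. by have := @outputU h set0 set0 (setI0 _); rewrite setU0; lra. Qed.

Lemma outputC h S : output A h (~` S) = 1 - output A h S.
Proof. by rewrite -(outputT h) -(setUv S) outputU ?setICr // addrAC subrr add0r. Qed.

Lemma output_le h S T : S `<=` T -> output A h S <= output A h T.
Proof.
move=> ST; rewrite -(setDUK ST) outputU ?lerDl ?output_ge0 //.
by rewrite setDE setICA setICr setI0.
Qed.

Lemma output_le1 h S : output A h S <= 1.
Proof. by rewrite -(outputT h); apply: output_le. Qed.

Lemma output_disjoint h S T : S `&` T = set0 -> output A h T <= 1 - output A h S.
Proof.
by move=> ST; rewrite -outputC; apply: output_le; rewrite -disjoints_subset setIC.
Qed.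

Lemma output_partition (I : finType) (f : 'rV[R]_d -> I) h S :
  output A h S = \sum_(i : I) output A h (S `&` [set b | f b = i]).
Proof.
transitivity (output A h (S `&` [set b | f b \in enum I])).
  congr output; apply/seteqP; split=> [b Sb|b []//].
  by split=> //=; rewrite mem_enum.
rewrite -[RHS]big_enum /=; elim: (enum I) (enum_uniq I) => [|i s IH] /=.
  rewrite big_nil => _; rewrite -[RHS](output0 h); congr output.
  by apply/seteqP; split=> b // [].
move=> /andP[iNs /IH {}IH]; rewrite big_cons -IH -outputU.
  congr output; apply/seteqP; split=> b /=.
    by case=> Sb; rewrite inE => /orP[/eqP|]; [left|right].
  by case=> -[Sb fb]; split=> //; rewrite inE ?fb ?eqxx ?orbT.
by apply/seteqP; split=> b //= -[[_ ->] [_ is_]]; rewrite is_ in iNs.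
Qed.

(* [output] is only finitely additive, so the expected number of the [B i] that
   contain the output is computed over the finite partition they generate. *)
Lemma sum_output_le m (B : 'I_m -> 'rV[R]_d -> bool) (k : R) h S :
  0 <= k -> (forall b, S b -> \sum_(i < m) (B i b)%:R <= k) ->
  \sum_(i < m) output A h [set b | B i b] <= k + m%:R * (1 - output A h S).
Proof.
move=> k0 Sk; pose f b := [ffun i : 'I_m => B i b].
pose w (t : {ffun 'I_m -> bool}) : R := \sum_(i < m) (t i)%:R.
have wm t : w t <= m%:R.
  by rewrite -[X in X%:R](card_ord m) -sumr_const; apply: ler_sum => i _; rewrite lern1 leq_b1.
have -> : \sum_(i < m) output A h [set b | B i b] =
    \sum_t w t * output A h [set b | f b = t].
  under eq_bigr do rewrite (output_partition f).
  rewrite exchange_big /=; apply: eq_bigr => t _; rewrite mulr_suml.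
  apply: eq_bigr => i _; have [ti|ti] := boolP (t i).
    rewrite mul1r; congr output; apply/seteqP; split=> b //=; first by case.
    by move=> fb; split=> //; move: ti; rewrite -fb ffunE.
  rewrite mul0r -[RHS](output0 h); congr output; apply/seteqP; split=> b //=.
  by case=> bB fb; rewrite -fb ffunE bB in ti.
have Ssplit t : output A h [set b | f b = t] =
    output A h (S `&` [set b | f b = t]) + output A h (~` S `&` [set b | f b = t]).
  rewrite -outputU; last by rewrite setIACA setICr set0I.
  by rewrite -setIUl setUv setTI.
apply: (@le_trans _ _ (k * output A h S + m%:R * output A h (~` S))); last first.
  by rewrite outputC lerD2r ler_piMr // output_le1.
rewrite (output_partition f h S) (output_partition f h (~` S)) !mulr_sumr -big_split.
apply: ler_sum => t _ /=; rewrite Ssplit mulrDr lerD //; last first.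
  by rewrite ler_wpM2r ?output_ge0.
(* A block meeting [S] has count [w t <= k], read off at any of its points in [S]; otherwise its
   part in [S] has mass 0. *)
have [->|/set0P[b [Sb <-]]] := eqVneq (S `&` [set b | f b = t]) set0.
  by rewrite output0 !mulr0.
rewrite ler_wpM2r ?output_ge0 // (le_trans _ (Sk b Sb)) //.
by apply: ler_sum => i _; rewrite ffunE.
Qed.

End Outputs.

(** * Biased coins indexed by sign vectors, and Assouad's argument *)

Section Coins.
Set Implicit Arguments. Unset Strict Implicit.
Variables (R : realType) (d : nat) (eta : R).
Hypotheses (eta0 : 0 <= eta) (eta_half : eta <= 1 / 2).
Implicit Types (s : {ffun 'I_d -> bool}) (nq : seq ('I_d * bool) -> 'I_d -> R).

Definition coins s (i : 'I_d) : R := if s i then 1 / 2 + eta else 1 / 2 - eta.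

Definition flip (i : 'I_d) s : {ffun 'I_d -> bool} :=
  [ffun j => if j == i then ~~ s j else s j].

Lemma flipK i : involutive (flip i).
Proof. by move=> s; apply/ffunP => j; rewrite !ffunE; case: eqP => // _; rewrite negbK. Qed.

Lemma label_prob_ge0 (q : 'I_d -> R) x : is_conditional q -> 0 <= label_prob q x.
Proof. by case: x => i [] /(_ i) /andP[q0 q1]; rewrite /label_prob //= subr_ge0. Qed.

Lemma label_prob_sum (q : 'I_d -> R) i :
  label_prob q (i, true) + label_prob q (i, false) = 1.
Proof. by rewrite /label_prob /= addrC subrK. Qed.

Lemma coins_conditional s : is_conditional (coins s).
Proof. have [e0 e1] := (eta0, eta_half).
by move=> i; rewrite /coins; case: (s i); apply/andP; split; lra. Qed.

(** The geometric mean of the label laws of [s] and [flip i s]: they agree away from [i], and at [i]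
    either label gives [(1/2 + eta) * (1/2 - eta)] under the root. *)
Definition coin_affinity s (i : 'I_d) (x : 'I_d * bool) : R :=
  if x.1 == i then Num.sqrt (1 / 4 - eta ^+ 2) else label_prob (coins s) x.

Lemma coin_affinity_ge0 s i x : 0 <= coin_affinity s i x.
Proof.
rewrite /coin_affinity; case: eqP => _; first exact: sqrtr_ge0.
exact/label_prob_ge0/coins_conditional.
Qed.

Lemma variance_ge0 : 0 <= 1 / 4 - eta ^+ 2.
Proof.
have [e0 e1] := (eta0, eta_half).
have : (1 / 2 - eta) * (1 / 2 + eta) >= 0 by rewrite mulr_ge0 //; lra.
lra.
Qed.

Lemma coin_affinity_sqr s i x : coin_affinity s i x ^+ 2 =
  label_prob (coins s) x * label_prob (coins (flip i s)) x.
Proof.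
case: x => j b; rewrite /coin_affinity /label_prob /coins /= ffunE.
case: eqP => _; last by rewrite expr2.
rewrite sqr_sqrtr ?variance_ge0 //.
by case: b (s j) => -[] /=; field.
Qed.

(** The Hellinger affinity of two coins with biases [1/2 + eta] and [1/2 - eta]. *)
Definition affinity : R := 2 * Num.sqrt (1 / 4 - eta ^+ 2).

Lemma affinity_sqr : affinity ^+ 2 = 1 - 4 * eta ^+ 2.
Proof. by rewrite /affinity exprMn sqr_sqrtr ?variance_ge0 //; field. Qed.

Lemma affinity_ge0 : 0 <= affinity.
Proof. by rewrite mulr_ge0 // sqrtr_ge0. Qed.

Lemma affinity_le1 : affinity <= 1.
Proof.
rewrite -(ler_pXn2r (n := 2)) ?nnegrE ?affinity_ge0 // affinity_sqr.
by have := sqr_ge0 eta; lra.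
Qed.

(** As [affinity] lies between 0 and 1, it is at least its square [1 - 4 * eta ^+ 2]. *)
Lemma affinity_gap : 1 - affinity <= 4 * eta ^+ 2.
Proof.
have := affinity_sqr; have := affinity_ge0; have := affinity_le1.
move=> r1 r0 r2.
have : affinity ^+ 2 <= affinity by rewrite expr2 ler_piMr.
lra.
Qed.

Lemma coin_affinity_sum s i j :
  coin_affinity s i (j, true) + coin_affinity s i (j, false) =
  if j == i then affinity else 1.
Proof.
rewrite /coin_affinity /affinity /=; case: eqP => _; first by ring.
exact: label_prob_sum.
Qed.

Notation lab s := (label_prob (coins s)).

Lemma sum_min_flip_ge nq m s i (k c : R) : policy nq ->
  0 <= c -> 0 <= k -> k ^+ 2 <= 4 * (c * (1 + c)) ->
  k * transcript_sum nq (coin_affinity s i) m - 2 * c <=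
  \sum_(h : m.-tuple ('I_d * bool)) Num.min (weight nq (lab s) h)
                                          (weight nq (lab (flip i s)) h).
Proof.
move=> pnq c0 k0 kc; apply: sum_min_ge => //.
- by move=> x; apply/label_prob_ge0/coins_conditional.
- by move=> x; apply/label_prob_ge0/coins_conditional.
- exact: coin_affinity_ge0.
- exact: coin_affinity_sqr.
- by move=> j; apply: label_prob_sum.
- by move=> j; apply: label_prob_sum.
Qed.

(* [beta i h] is the probability that the output rounds to 1 at point [i]. *)
Lemma assouad nq m (beta : 'I_d -> m.-tuple ('I_d * bool) -> R) : policy nq ->
  (forall i h, 0 <= beta i h <= 1) ->
  (forall s, \sum_h weight nq (lab s) h *
     \sum_(i < d) (if s i then 1 - beta i h else beta i h) <= 3 / 8 * d%:R) ->
  d%:R <= 128 * eta ^+ 2 * m%:R.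
Proof.
move=> pnq beta01 err_le.
pose err i s h := if s i then 1 - beta i h else beta i h.
pose V s i := visit_sum nq (lab s) m i.
have pair_err i s : 7 / 8 - 2 * (1 - affinity) * (V s i + V (flip i s) i) <=
    \sum_h (weight nq (lab s) h * err i s h +
            weight nq (lab (flip i s)) h * err i (flip i s) h).
  (* Here [k = 4] and [c = 25/16], admissible since [16 <= 4 * (25/16) * (41/16)]. They leave
     [4 - 25/8 = 7/8], above the [2 * (3/8)] allowed per pair. *)
  apply: (@le_trans _ _ (4 * transcript_sum nq (coin_affinity s i) m - 2 * (25 / 16))).
    have := @affinity_ge R d nq (lab s) (lab (flip i s)) (coin_affinity s i) m i
      affinity pnq.
    rewrite -/(V s i) -/(V (flip i s) i).
    have lab0 s' x : 0 <= lab s' x by apply/label_prob_ge0/coins_conditional.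
    move=> /(_ (lab0 s) (lab0 _) (coin_affinity_ge0 s i) (coin_affinity_sqr s i)).
    move=> /(_ (label_prob_sum _) (label_prob_sum _) affinity_le1 (coin_affinity_sum s i)).
    lra.
  apply: (le_trans (@sum_min_flip_ge nq m s i 4 (25 / 16) pnq _ _ _)); [lra..|].
  apply: ler_sum => h _; rewrite /err ffunE eqxx.
  case: (s i) => /=; first exact: min_le_mix.
  rewrite -[X in _ * X + _](subKr 1); apply: min_le_mix.
  by have /andP[b0 b1] := beta01 i h; rewrite subr_ge0 b1 gerBl.
(* Since [flip i] permutes the sign vectors, both members of a pair contribute the same sum over
   [s]. *)
have flip_sum i (F : {ffun 'I_d -> bool} -> R) : \sum_s F (flip i s) = \sum_s F s.
  by rewrite [RHS](reindex_inj (inv_inj (flipK i))).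
pose N : R := #|{ffun 'I_d -> bool}|%:R.
have N0 : 0 < N by rewrite ltr0n card_ffun card_bool expn_gt0.
have sumN (x : R) : \sum_(s : {ffun 'I_d -> bool}) x = N * x.
  by rewrite sumr_const -mulr_natl.
have upper : \sum_i \sum_s \sum_h weight nq (lab s) h * err i s h <= N * (3 / 8 * d%:R).
  rewrite exchange_big /= -sumN; apply: ler_sum => s _.
  rewrite exchange_big /=; apply: le_trans (err_le s); apply: ler_sum => h _.
  by rewrite mulr_sumr.
have lower : \sum_i \sum_s (7 / 8 - 2 * (1 - affinity) * (V s i + V (flip i s) i)) <=
    2 * \sum_i \sum_s \sum_h weight nq (lab s) h * err i s h.
  rewrite mulr_sumr; apply: ler_sum => i _.
  apply: le_trans (ler_sum _ (fun s _ => pair_err i s)) _.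
  under eq_bigr do rewrite big_split.
  rewrite big_split /= (flip_sum i (fun s => \sum_h weight nq (lab s) h * err i s h)).
  by rewrite mulr_natl mulr2n.
have sumV : \sum_i \sum_s (7 / 8 - 2 * (1 - affinity) * (V s i + V (flip i s) i)) =
    N * (7 / 8 * d%:R - 4 * (1 - affinity) * m%:R).
  transitivity (\sum_(i < d) (N * (7 / 8) - 4 * (1 - affinity) * \sum_s V s i)).
    apply: eq_bigr => i _.
    by rewrite sumrB sumN -mulr_sumr big_split /= (flip_sum i (fun s => V s i)); ring.
  rewrite sumrB sumr_const card_ord -mulr_sumr exchange_big /= -mulr_natl.
  rewrite (eq_bigr (fun=> m%:R)) => [|s _]; first by rewrite sumN; ring.
  by rewrite sum_visit_sum // => j; apply: label_prob_sum.
have : N * (7 / 8 * d%:R - 4 * (1 - affinity) * m%:R) <= N * (3 / 4 * d%:R).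
  by rewrite -sumV (le_trans lower) //; lra.
rewrite ler_pM2l // => final.
have := ler_wpM2r (ler0n R m) affinity_gap.
lra.
Qed.

(** A test between two neighbours: [phi h] is the probability of deciding for [s]. The affinity of
    the transcripts is at least [affinity ^+ m], as each query costs at most one factor. *)
Lemma two_point nq m s i (phi : m.-tuple ('I_d * bool) -> R) (del : R) :
  policy nq -> (forall h, 0 <= phi h <= 1) ->
  \sum_h weight nq (lab s) h * (1 - phi h) <= del ->
  \sum_h weight nq (lab (flip i s)) h * phi h <= del ->
  (1 - 4 * eta ^+ 2) ^+ m <= 4 * del.
Proof.
move=> pnq phi01 err0 err1.
have [a0 a1] := (affinity_ge0, affinity_le1).
rewrite -affinity_sqr exprAC; have r0 : 0 <= affinity ^+ m by rewrite exprn_ge0.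
have : affinity ^+ m <= transcript_sum nq (coin_affinity s i) m.
  apply: transcript_sum_ge => // [x|j]; first exact: coin_affinity_ge0.
  by rewrite coin_affinity_sum; case: ifP.
(* With [k = r] and [c = r ^+ 2 / 4], the bound is at least [r ^+ 2 - r ^+ 2 / 2], while the two
   errors add up to at most [2 * del]. *)
have := @sum_min_flip_ge nq m s i (affinity ^+ m) (affinity ^+ m / 2 * (affinity ^+ m / 2)) pnq.
set r := affinity ^+ m in r0 *.
have c0 : 0 <= r / 2 * (r / 2) by rewrite mulr_ge0 // divr_ge0.
have c2 : 0 <= (r / 2 * (r / 2)) ^+ 2 by exact: sqr_ge0.
move=> /(_ c0 r0); have k_c : r ^+ 2 <= 4 * (r / 2 * (r / 2) * (1 + r / 2 * (r / 2))) by lra.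
move=> /(_ k_c) lo rT.
have up : \sum_(h : m.-tuple ('I_d * bool)) Num.min (weight nq (lab s) h)
    (weight nq (lab (flip i s)) h) <= del + del.
  apply: le_trans (lerD err0 err1); rewrite -big_split /=; apply: ler_sum => h _.
  exact: min_le_mix.
have := ler_wpM2l r0 rT; rewrite -expr2.
lra.
Qed.

End Coins.

(** * Regression on the standard basis: what good outputs reveal *)

Section BasisRegression.
Set Implicit Arguments. Unset Strict Implicit.
Variables (R : realType) (d : nat).
Implicit Types (p q : 'I_d -> R) (eps : R).
Local Open Scope classical_set_scope.

Definition basis (i : 'I_d) : 'rV[R]_d := delta_mx 0 i.

Lemma basis_inj : injective basis.
Proof.
move=> i j /matrixP/(_ 0 j); rewrite !mxE !eqxx /= eq_sym.
by case: eqP => // _ /eqP; rewrite eq_sym oner_eq0.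
Qed.

Lemma basis_riskE p q (b : 'rV[R]_d) : l1_risk basis 0 1 p q b =
  \sum_(i < d) p i * (q i * `|b 0 i - 1| + (1 - q i) * `|b 0 i|).
Proof.
by apply: eq_bigr => i _; rewrite /dotv -rowE !mxE subr0.
Qed.

(** Risks are nonnegative, so [inf] is a genuine lower bound and any competitor [b'] may stand in
    for it. *)
Lemma good_set_le p q eps (b b' : 'rV[R]_d) : is_marginal p -> is_conditional q ->
  0 <= eps -> good_set basis 0 1 p q eps b ->
  l1_risk basis 0 1 p q b <= (1 + eps) * l1_risk basis 0 1 p q b'.
Proof.
move=> [p0 _] q01 eps0 /le_trans; apply; rewrite ler_wpM2l ?addr_ge0 //.
apply: ge_inf; last by exists b'.
exists 0 => _ [c _ <-]; apply: sumr_ge0 => i _; have /andP[q0 q1] := q01 i.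
by rewrite mulr_ge0 // addr_ge0 // mulr_ge0 // subr_ge0.
Qed.

(** The expected loss is piecewise linear: [1/2 - eta] at the likelier label, [1/2] at the midpoint,
    and no less beyond it. Rounding to the wrong side thus costs an extra [eta]. *)
Lemma coin_risk_ge (eta x q : R) (s : bool) : 0 <= eta -> eta <= 1 / 2 ->
  q = (if s then 1 / 2 + eta else 1 / 2 - eta) ->
  1 / 2 - eta + eta * ((1 / 2 < x) != s)%:R <= q * `|x - 1| + (1 - q) * `|x|.
Proof.
move=> e0 e1 qE.
have n0 : x <= `|x| by exact: ler_norm.
have n1 : 1 - x <= `|x - 1| by rewrite distrC ler_norm.
have q0 : 0 <= q /\ 0 <= 1 - q by rewrite qE; case: s {qE}; split; lra.
have := ler_wpM2l q0.1 n1; have := ler_wpM2l q0.2 n0.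
have := normr_ge0 x; have := normr_ge0 (x - 1); rewrite qE.
case: s {qE q0}; case: ltP => /= hx *; nra.
Qed.

Lemma marginal_mean (p : 'I_d -> R) x : is_marginal p -> \sum_(i < d) p i * x = x.
Proof. by case=> _ p1; rewrite -mulr_suml p1 mul1r. Qed.

(** The optimal risk is at most [1/2 - 4 * eps], so the slack is below [eps / 2], while each unit of
    wrongly rounded mass costs [4 * eps]. *)
Lemma good_set_coins p eps (s : {ffun 'I_d -> bool}) (b : 'rV[R]_d) :
  is_marginal p -> 0 < eps -> eps < 10^-1 ->
  good_set basis 0 1 p (coins (4 * eps) s) eps b ->
  \sum_(i < d) p i * ((1 / 2 < b 0 i) != s i)%:R <= 1 / 8.
Proof.
move=> pm eps0 eps1 gb; have [p0 _] := pm.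
have e0 : 0 <= 4 * eps by lra.
have e1 : 4 * eps <= 1 / 2 by lra.
have := good_set_le (\row_i (s i)%:R) pm (coins_conditional e0 e1 s) (ltW eps0) gb.
have -> : l1_risk basis 0 1 p (coins (4 * eps) s) (\row_i (s i)%:R) =
    1 / 2 - 4 * eps.
  rewrite basis_riskE -[RHS](marginal_mean _ pm); apply: eq_bigr => i _.
  rewrite mxE /coins; congr (_ * _); case: (s i) => /=.
    by rewrite mulr1n subrr normr0 normr1; field.
  by rewrite mulr0n sub0r normrN normr1 normr0; field.
set W := \sum_i _; rewrite basis_riskE => risk_le.
have : 1 / 2 - 4 * eps + 4 * eps * W <= (1 + eps) * (1 / 2 - 4 * eps).
  apply: le_trans risk_le.
  rewrite -[X in X + _](marginal_mean _ pm) mulr_sumr -big_split /=.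
  apply: ler_sum => i _; rewrite mulrCA -mulrDr ler_wpM2l //.
  exact: coin_risk_ge.
move=> le_W; have : 4 * eps * W <= 4 * eps * (1 / 8) by have := sqr_ge0 eps; lra.
by rewrite ler_pM2l //; lra.
Qed.

Lemma failure_le n m (A : learner R n d) (q : 'I_n -> R) S (delta : R) : valid_learner A ->
  1 - delta <= output_prob m A q S ->
  \sum_(h : m.-tuple ('I_n * bool))
    weight (next_query A) (label_prob q) h * (1 - output A h S) <= delta.
Proof.
move=> vA; under eq_bigr do rewrite mulrBr mulr1.
rewrite sumrB -/(transcript_sum _ _ m) transcript_sum_eq1.
- by rewrite lerBlDr -lerBlDl.
- exact: next_query_policy.
- by move=> j; apply: label_prob_sum.
Qed.

Lemma uniform_marginal : (0 < d)%N -> is_marginal (fun _ : 'I_d => d%:R^-1 : R).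
Proof.
move=> d0; split=> [i|]; first by rewrite invr_ge0.
by rewrite sumr_const card_ord -[LHS]mulr_natr mulVf // pnatr_eq0 -lt0n.
Qed.

Lemma point_marginal (i : 'I_d) : is_marginal (fun j : 'I_d => (j == i)%:R : R).
Proof.
split=> [j|]; first exact: ler0n.
by rewrite (bigD1 i) //= eqxx big1 ?addr0 // => j /negbTE ->.
Qed.

(** * The three lower bounds on the number of samples *)

Variables (m : nat) (eps delta : R) (A : ('I_d -> R) -> learner R d d).
Hypotheses (d_gt0 : (0 < d)%N) (eps0 : 0 < eps) (eps1 : eps < 10^-1).
Hypothesis delta1 : delta < 4^-1.
Hypothesis solvesA : solves m basis 0 1 eps delta A.

Lemma dimension_bound : d%:R <= 2048 * eps ^+ 2 * m%:R.
Proof.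
have [e0 [e1 del1]] := (eps0, (eps1, delta1)).
have dR : 0 < d%:R :> R by rewrite ltr0n.
have [vA sA] := solvesA (uniform_marginal d_gt0).
set B := A _ in vA sA.
suff : d%:R <= 128 * (4 * eps) ^+ 2 * m%:R by lra.
apply: (@assouad R d (4 * eps) _ _ (next_query B) m
    (fun i h => output B h [set b | 1 / 2 < b 0 i])).
- by lra.
- by lra.
- exact: next_query_policy.
- by move=> i h; rewrite output_ge0 // output_le1.
move=> s; set S := good_set basis 0 1 (fun=> d%:R^-1) (coins (4 * eps) s) eps.
have cq : is_conditional (coins (4 * eps) s) by apply: coins_conditional; lra.
have fail := failure_le vA (sA _ cq).
have /= bound (h : m.-tuple ('I_d * bool)) := @sum_output_le R d d B vA d
  (fun i b => (1 / 2 < b 0 i) != s i) (d%:R / 8) h S.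
set W := weight _ _ in fail *.
(* A good output has at most [d / 8] wrong signs, and a bad one, of probability at most
   [delta < 1/4], at most [d]; in total [3/8 * d]. *)
apply: (@le_trans _ _ (\sum_h (W m h * (d%:R / 8) +
    d%:R * (W m h * (1 - output B h S))))).
  apply: ler_sum => h _; rewrite [d%:R * (_ * _)]mulrCA -mulrDr ler_wpM2l //.
    apply: weight_ge0; first exact: next_query_policy.
    by move=> x; apply: label_prob_ge0.
  apply: le_trans (bound h _ _); last first.
  - move=> b /good_set_coins -/(_ (uniform_marginal d_gt0) eps0 eps1).
    by rewrite -mulr_sumr ler_pdivrMl // => /le_trans; apply; lra.
  - by rewrite divr_ge0.
  apply: ler_sum => i _; case: (s i).
    rewrite -outputC //; apply: output_le => // b /=.
    by move/negP/negbTE => ->.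
  by apply: output_le => // b /= ->.
rewrite big_split /= -mulr_suml -mulr_sumr -/(transcript_sum _ _ m) transcript_sum_eq1.
- by have := ler_wpM2l (ltW dR) fail; have := ler_wpM2l (ltW dR) (ltW del1); lra.
- exact: next_query_policy.
- by move=> j; apply: label_prob_sum.
Qed.

Lemma noise_bound : (1 - 64 * eps ^+ 2) ^+ m <= 4 * delta.
Proof.
have [e0 e1] := (eps0, eps1).
move: (Ordinal d_gt0) => i; pose s := [ffun _ : 'I_d => true].
have [vA sA] := solvesA (point_marginal i).
set B := A _ in vA sA.
have cq (t : {ffun 'I_d -> bool}) : is_conditional (coins (4 * eps) t) by apply: coins_conditional; lra.
have rounds (t : {ffun 'I_d -> bool}) b :
    good_set basis 0 1 (fun j => (j == i)%:R) (coins (4 * eps) t) eps b ->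
    (1 / 2 < b 0 i) = t i.
  move/good_set_coins => /(_ (point_marginal i) eps0 eps1).
  rewrite (bigD1 i) //= eqxx mul1r big1 ?addr0 => [|j /negbTE ->]; last by rewrite mul0r.
  (* With all mass at [i] the wrong mass is 0 or 1, so a bound of [1/8] forces 0. *)
  by case: eqP => //= _; lra.
have := @two_point R d (4 * eps) _ _ (next_query B) m s i
  (fun h => output B h [set b | 1 / 2 < b 0 i]) delta.
have -> : 1 - 4 * (4 * eps) ^+ 2 = 1 - 64 * eps ^+ 2 by ring.
apply.
- by lra.
- by lra.
- exact: next_query_policy.
- by move=> h; rewrite output_ge0 // output_le1.
- apply: (le_trans _ (failure_le vA (sA _ (cq s)))); apply: ler_sum => h _.
  rewrite ler_wpM2l //.
    apply: weight_ge0; first exact: next_query_policy.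
    by move=> x; apply: label_prob_ge0.
  by rewrite lerB //; apply: output_le => // b /rounds; rewrite ffunE.
- apply: (le_trans _ (failure_le vA (sA _ (cq (flip i s))))); apply: ler_sum => h _.
  rewrite ler_wpM2l //.
    apply: weight_ge0; first exact: next_query_policy.
    by move=> x; apply: label_prob_ge0.
  apply: output_disjoint => //; apply/seteqP; split=> b //= -[/rounds ->].
  by rewrite !ffunE eqxx.
Qed.

Lemma coverage_bound : (0 < m)%N -> expR (- (6 * m%:R / d%:R)) <= 4 * delta.
Proof.
move=> m_gt0; have [e0 [e1 del1]] := (eps0, (eps1, delta1)).
have dR : 0 < d%:R :> R by rewrite ltr0n.
have mR : 0 < m%:R :> R by rewrite ltr0n.
have um := uniform_marginal d_gt0.
have [vA sA] := solvesA um.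
set p : 'I_d -> R := fun=> d%:R^-1 in um vA sA.
set B := A _ in vA sA.
have pB := next_query_policy vA.
pose q0 : 'I_d -> R := fun=> 0.
have cq0 : is_conditional q0 by move=> i; rewrite lexx ler01.
pose V i := visit_sum (next_query B) (label_prob q0) m i.
(* The expected visits sum to [m], so the least visited point gets at most the average. *)
have [i Vi] : exists i, V i <= m%:R / d%:R.
  have [i _ minV] := Order.TotalTheory.arg_minP V (isT : xpredT (Ordinal d_gt0)).
  exists i; rewrite ler_pdivlMr // mulr_natr.
  rewrite -(sum_visit_sum m pB (label_prob_sum q0)) -[X in _ *+ X]card_ord -sumr_const.
  by apply: ler_sum => j _; apply: minV.
pose q1 : 'I_d -> R := fun j => if j == i then 3 / 4 else 0.
have cq1 : is_conditional q1.
  by move=> j; rewrite /q1; case: eqP => _; apply/andP; split; lra.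
pose S0 := good_set basis 0 1 p q0 eps; pose S1 := good_set basis 0 1 p q1 eps.
(* Under [q0] the optimum is 0, forcing [b 0 i = 0]. Under [q1] this costs at least [3/4] at [i],
   against [1/4] for the competitor [delta_mx 0 i], both scaled by the mass of [i]. *)
have S01 : S1 `&` S0 = set0.
  apply/seteqP; split=> b //= -[].
  move=> /(good_set_le (delta_mx 0 i) um cq1 (ltW eps0)) r1.
  move=> /(good_set_le 0 um cq0 (ltW eps0)) r0.
  have bi : b 0 i = 0.
    apply/normr0_eq0/le_anti; rewrite normr_ge0 andbT.
    have : d%:R^-1 * `|b 0 i| <= 0; last by rewrite pmulr_rle0 // invr_gt0.
    move: r0; rewrite !basis_riskE [X in _ * X]big1 => [|j _]; last first.
      by rewrite /q0 mxE normr0; ring.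
    rewrite mulr0; apply: le_trans; rewrite (bigD1 i) //= /q0 mul0r add0r subr0 mul1r.
    rewrite lerDl sumr_ge0 // => j _.
    by rewrite mul0r add0r mul1r mulr_ge0 // invr_ge0.
  have q1i : q1 i = 3 / 4 by rewrite /q1 eqxx.
  have risk_i : l1_risk basis 0 1 p q1 (delta_mx 0 i) = d%:R^-1 * (1 / 4).
    rewrite basis_riskE (bigD1 i) //= big1 => [|j /negbTE ji]; last first.
      by rewrite /q1 !mxE ji /= normr0; ring.
    by rewrite mxE !eqxx q1i mulr1n subrr normr0 normr1 /p; field; rewrite gt_eqF.
  move: r1; rewrite risk_i basis_riskE.
  apply/negP; rewrite -ltNge (bigD1 i) //= bi q1i normr0 sub0r normrN normr1.
  apply: (@lt_le_trans _ _ (d%:R^-1 * (3 / 4 * 1 + (1 - 3 / 4) * 0))).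
    by rewrite /p mulrCA ltr_pM2l ?invr_gt0 //; lra.
  rewrite lerDl sumr_ge0 // => j _; have /andP[c0 c1] := cq1 j.
  rewrite mulr_ge0 ?invr_ge0 // addr_ge0 // mulr_ge0 // subr_ge0 //.
(* A label 0 at [i] has likelihood ratio [1/4], so [lam = 3] is admissible in
   [change_of_measure]. *)
have e3 : expR (- 3) <= 4^-1 :> R.
  rewrite expRN lef_pV2 ?posrE ?expR_gt0 //.
  by have := expR_ge1Dx (3 : R); lra.
(* Twice the bound on the mean visits, so the Markov term is at most [1/2]. *)
pose tau : R := 2 * (m%:R / d%:R).
have tau0 : 0 < tau by rewrite mulr_gt0 // divr_gt0.
have := @change_of_measure R d (next_query B) (label_prob q0) (label_prob q1) m i 3 tau
  (fun h => output B h S0) pB (fun x => label_prob_ge0 x cq0) _ tau0.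
have l01 x : label_prob q0 x * expR (- (3 * (x.1 == i)%:R)) <= label_prob q1 x.
  case: x => j [] /=; rewrite /label_prob /q0 /q1 /=.
    by rewrite mul0r; case: eqP => // _; lra.
  rewrite subr0 mul1r; case: eqP => _; last by rewrite mulr0 oppr0 exp.expR0; lra.
  by rewrite mulr1n mulr1 (le_trans e3) //; lra.
move=> /(_ (ler0n _ 3) l01).
have out01 (h : m.-tuple ('I_d * bool)) : 0 <= output B h S0 <= 1.
  by rewrite output_ge0 // output_le1.
move=> /(_ out01) lower.
have upper : \sum_(h : m.-tuple ('I_d * bool))
    weight (next_query B) (label_prob q1) h * output B h S0 <= delta.
  apply: (le_trans _ (failure_le vA (sA _ cq1))); apply: ler_sum => h _.
  rewrite ler_wpM2l //; last exact: output_disjoint.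
  by apply: weight_ge0 => // x; apply: label_prob_ge0.
have V_half : visit_sum (next_query B) (label_prob q0) m i / tau <= 1 / 2.
  by rewrite ler_pdivrMr // -/(V i) (le_trans Vi) // /tau; lra.
have P0 := sA _ cq0; rewrite -/S0 in P0.
have -> : - (6 * m%:R / d%:R) = - (3 * tau) by rewrite /tau; ring.
have := le_trans lower upper.
set E := expR _ => le_delta.
have E0 : 0 <= E by exact: expR_ge0.
(* What remains is [1 - delta - 1/2], at least [1/4]. *)
have : E * (1 / 4) <= delta; last lra.
apply: le_trans le_delta; rewrite ler_wpM2l //.
move: P0; rewrite /output_prob -/(weight _ _ _) => P0.
lra.
Qed.

End BasisRegression.

(** * Combination of the three bounds with an explicit constant *)

(** Below [1/16] one has [(4 * delta) ^+ 2 <= delta], so squaring the hypothesis absorbs the factor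
    4. *)
Lemma ln_inv_le (R : realType) (delta x : R) : 0 < delta -> delta < 16^-1 ->
  expR (- x) <= 4 * delta -> ln delta^-1 <= 2 * x.
Proof.
move=> del0 del1 le_del; rewrite exp.lnV ?posrE // lerNl -(exp.expRK (- _)).
rewrite exp.ler_ln ?posrE ?expR_gt0 //.
apply: (@le_trans _ _ ((4 * delta) ^+ 2)); last first.
  by have := ler_wpM2l (ltW del0) (ltW del1); lra.
by rewrite -mulrN mulrC exp.expRM_natr ler_pXn2r ?nnegrE ?expR_ge0 // mulr_ge0 // ltW.
Qed.

Lemma sample_lower_bound (R : realType) (d m : nat) (eps delta : R)
    (A : ('I_d -> R) -> learner R d d) :
  (0 < d)%N -> 0 < eps -> eps < 10^-1 -> 0 < delta -> delta < 4^-1 ->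
  solves m (@basis R d) 0 1 eps delta A ->
  256^-1 ^+ 2 * (d%:R / eps ^+ 2 + (eps ^+ 2)^-1 * ln (delta^-1)
                 + d%:R * ln (delta^-1)) <= m%:R.
Proof.
move=> d0 eps0 eps1 del0 del1 slv.
have d1 : 1 <= d%:R :> R by rewrite ler1n.
have e20 : 0 < eps ^+ 2 by exact: exprn_gt0.
have e21 : eps ^+ 2 < 100^-1.
  have : 0 < eps * (10^-1 - eps) by rewrite mulr_gt0 // subr_gt0.
  lra.
have dim := dimension_bound d0 eps0 eps1 del1 slv.
have m0 : (0 < m)%N.
  by rewrite lt0n; apply/eqP => mE; move: dim; rewrite mE mulr0; lra.
have mR : 0 < m%:R :> R by rewrite ltr0n.
have dim' : d%:R / eps ^+ 2 <= 2048 * m%:R.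
  by rewrite ler_pdivrMr //; lra.
set L := ln _.
have [del16|del16] := leP 16^-1 delta.
  (* From [ln x <= x - 1] at [x = delta^-1 <= 16]. *)
  have L15 : L <= 15.
    have : delta^-1 <= 16 by rewrite -[leRHS]invrK lef_pV2 ?posrE ?invr_gt0.
    have := @exp.le_ln1Dx R (delta^-1 - 1); rewrite addrCA subrr addr0 -/L.
    have : 0 < delta^-1 by rewrite invr_gt0.
    by move=> ? /(_ _) le_L ?; have := le_L ltac:(lra); lra.
  have noise : (eps ^+ 2)^-1 * L <= 15 * (d%:R / eps ^+ 2).
    rewrite [d%:R / _]mulrC mulrCA ler_wpM2l ?invr_ge0 ?(ltW e20) //; lra.
  have cover : d%:R * L <= 15 * (d%:R / eps ^+ 2).
    rewrite mulrCA ler_wpM2l // (le_trans L15) // ler_peMr //.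
    by rewrite invf_ge1 //; lra.
  lra.
have noise : L <= 384 * eps ^+ 2 * m%:R.
  suff : L <= 2 * (192 * eps ^+ 2 * m%:R) by lra.
  apply: ln_inv_le => //; apply: le_trans (noise_bound d0 eps0 eps1 slv).
  rewrite -mulNr exp.expRM_natr ler_pXn2r ?nnegrE ?expR_ge0 //; last lra.
  rewrite exp.expRN.
  (* The claim [expR (- 192 e) <= 1 - 64 e], for [e = eps ^+ 2 < 1/100], reduces to
     [1 <= (1 - 64 e) * (1 + 192 e)], that is [12288 e <= 128]. *)
  have a1 := exp.expR_ge1Dx (192 * eps ^+ 2).
  rewrite -[leLHS]mul1r ler_pdivrMr ?expR_gt0 //.
  have := ler_wpM2l (_ : 0 <= 1 - 64 * eps ^+ 2) a1.
  have := ler_wpM2l (ltW e20) (ltW e21).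
  by move=> ? /(_ ltac:(lra)); lra.
have cover : L <= 2 * (6 * m%:R / d%:R).
  by apply: ln_inv_le => //; apply: coverage_bound d0 eps0 eps1 del1 slv m0.
have noise' : (eps ^+ 2)^-1 * L <= 384 * m%:R.
  by rewrite mulrC ler_pdivrMr //; lra.
have cover' : d%:R * L <= 12 * m%:R.
  have := ler_wpM2l (ler0n R d) cover.
  have -> : d%:R * (2 * (6 * m%:R / d%:R)) = 12 * m%:R :> R.
    by field; rewrite gt_eqF //; lra.
  done.
lra.
Qed.

Theorem theorem5 :
  exists c : Rdefinitions.R, 0 < c /\
  forall (d : nat), (2 <= d)%N ->
  forall eps delta : Rdefinitions.R,
    0 < eps -> eps < 10^-1 -> 0 < delta -> delta < 4^-1 ->
  exists (n : nat) (pts : 'I_n -> 'rV[Rdefinitions.R]_d) (y0 y1 : Rdefinitions.R),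
    injective pts /\ y0 != y1 /\
    forall (m : nat) (A : ('I_n -> Rdefinitions.R) -> learner Rdefinitions.R n d),
      solves m pts y0 y1 eps delta A ->
      c * (d%:R / eps ^+ 2 + (eps ^+ 2)^-1 * ln (delta^-1)
           + d%:R * ln (delta^-1)) <= m%:R.
Proof.
(* The worst case is [delta >= 1/16], where the three terms total at most
   [(1 + 15 + 15) * 2048 * m], below [256 ^ 2 * m]. *)
exists (256^-1 ^+ 2); split; first by rewrite exprn_gt0 // invr_gt0.
move=> d d2 eps delta eps0 eps1 del0 del1.
exists d, (@basis Rdefinitions.R d), 0, 1; split; first exact: basis_inj.
split; first by rewrite eq_sym oner_eq0.
by move=> m A; apply: sample_lower_bound => //; apply: ltnW.
Qed.
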